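(* Let $(\mathcal K_n)_{n\ge 0}$ be one of the families $(\mathcal P_n)$, $(\mathcal B_n)$, $(\mathcal{PB}_n)$. Then for every $n\ge 0$, $$e(\mathcal K_n)=n!\cdot\sum_{\mu\vdash n}\ \prod_{i=1}^n\frac{c(\mathcal K_i)^{\mu_i}}{\mu_i!\,(i!)^{\mu_i}}.$$ Moreover, the numbers $e(\mathcal K_n)$ satisfy the recurrence $$e(\mathcal K_0)=1,\qquad e(\mathcal K_n)=\sum_{m=1}^n\binom{n-1}{m-1}c(\mathcal K_m)\,e(\mathcal K_{n-m})\quad\text{for } n\ge 1.$$
   Context: Write $\mathbf n=\{1,\dots,n\}$ and let $\mathbf n'$ be a disjoint copy. $\mathcal P_n$ is the monoid of all set partitions $\alpha$ (into non-empty blocks) of $\mathbf n\cup\mathbf n'$. Product: for $\alpha,\beta\in\mathcal P_n$ take a third copy $\mathbf n''$; relabel each lower vertex $x'$ of $\alpha$ as $x''$ and each upper vertex $x$ of $\beta$ as $x''$, and take the union graph $\Gamma(\alpha,\beta)$ on $\mathbf n\cup\mathbf n'\cup\mathbf n''$ (a partition being represented by a graph whose connected components are its blocks); $x,y\in\mathbf n\cup\mathbf n'$ are in the same block of $\alpha\beta$ iff they are joined by a path in $\Gamma(\alpha,\beta)$. $\mathcal{PB}_n$ is the submonoid of partitions all of whose blocks have size at most $2$, and $\mathcal B_n$ the submonoid of partitions all of whose blocks have size exactly $2$. $\mathcal P_0=\mathcal B_0=\mathcal{PB}_0=\{\emptyset\}$. For $\alpha\in\mathcal P_n$, $\ker^\wedge(\alpha)$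 (resp. $\ker_\vee(\alpha)$) is the equivalence on $\mathbf n$ relating $x,y$ iff $x,y$ (resp. $x',y'$) are in the same block of $\alpha$; $\ker(\alpha)=\ker^\wedge(\alpha)\vee\ker_\vee(\alpha)$ is the smallest equivalence containing both. $\alpha$ is irreducible if $\ker(\alpha)=\mathbf n\times\mathbf n$. For $\Sigma\subseteq\mathcal P_n$, $e(\Sigma)$ is the number of $\alpha\in\Sigma$ with $\alpha^2=\alpha$, and $c(\Sigma)$ is the number of irreducible $\alpha\in\Sigma$ with $\alpha^2=\alpha$. $\mu\vdash n$ means $\mu$ is an integer partition of $n$, and $\mu_i$ denotes the number of parts of $\mu$ equal to $i$; $\emptyset$ is the unique partition of $0$. *)

(* Defs.v *)
From HB Require Import structures.
From mathcomp Require Import all_boot all_order all_algebra.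
Set Implicit Arguments.
Unset Strict Implicit.
Unset Printing Implicit Defensive.

(* [inl x] is the upper vertex x and [inr x] the lower vertex x'; the points
   1, ..., n are represented by 0, ..., n - 1. *)
Definition vertex (n : nat) : finType := ('I_n + 'I_n)%type.

Record diagram (n : nat) := Diagram {
  blocks :> {set {set vertex n}};
  blocksP : partition blocks [set: vertex n]
}.

HB.instance Definition _ n := [isSub for @blocks n].
HB.instance Definition _ n := [Finite of diagram n by <:].

(* [inl v] is a vertex of the original two rows, [inr x] the third copy x''. *)
Definition vertex3 (n : nat) : finType := (vertex n + 'I_n)%type.

Definition relabel_lower n (v : vertex n) : vertex3 n :=
  match v with inl x => inl (inl x) | inr x => inr x end.

Definition relabel_upper n (v : vertex n) : vertex3 n :=
  match v with inl x => inr x | inr x => inl (inr x) end.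

(* Each block is represented by the complete graph on it (loops included). *)
Definition product_graph n (a b : diagram n) : rel (vertex3 n) := fun u v =>
  [exists A in blocks a,
     (u \in @relabel_lower n @: A) && (v \in @relabel_lower n @: A)] ||
  [exists B in blocks b,
     (u \in @relabel_upper n @: B) && (v \in @relabel_upper n @: B)].

Definition joined n (a b : diagram n) : rel (vertex n) := fun x y =>
  connect (product_graph a b) (inl x) (inl y).

Lemma product_graph_sym n (a b : diagram n) : symmetric (product_graph a b).
Proof.
by move=> u v; congr (_ || _); apply: eq_existsb => A; rewrite [X in _ && X]andbC.
Qed.

Lemma joined_equiv n (a b : diagram n) :
  {in [set: vertex n] & &, equivalence_rel (joined a b)}.
Proof.
move=> x y z _ _ _; split; first exact: connect0.
move=> xy; have cS := sym_connect_sym (product_graph_sym a b).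
exact: (same_connect cS xy).
Qed.

Definition diagram_mul n (a b : diagram n) : diagram n :=
  Diagram (equivalence_partitionP (@joined_equiv n a b)).

Definition all_partitions (n : nat) : {set diagram n} := [set: diagram n].

Definition brauer (n : nat) : {set diagram n} :=
  [set a : diagram n | [forall B in blocks a, #|B| == 2]].

Definition partial_brauer (n : nat) : {set diagram n} :=
  [set a : diagram n | [forall B in blocks a, #|B| <= 2]].

Definition is_equivalence (T : finType) (R : {set T * T}) : bool :=
  [&& [forall x, (x, x) \in R],
      [forall x, forall y, ((x, y) \in R) ==> ((y, x) \in R)] &
      [forall x, forall y, forall z,
         ((x, y) \in R) && ((y, z) \in R) ==> ((x, z) \in R)]].

(* The smallest equivalence containing R and S. *)
Definition equiv_join (T : finType) (R S : {set T * T}) : {set T * T} :=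
  \bigcap_(E : {set T * T} |
             [&& is_equivalence E, R \subset E & S \subset E]) E.

Definition ker_upper n (a : diagram n) : {set 'I_n * 'I_n} :=
  [set p | inl p.2 \in pblock (blocks a) (inl p.1)].

Definition ker_lower n (a : diagram n) : {set 'I_n * 'I_n} :=
  [set p | inr p.2 \in pblock (blocks a) (inr p.1)].

Definition diagram_ker n (a : diagram n) : {set 'I_n * 'I_n} :=
  equiv_join (ker_upper a) (ker_lower a).

Definition irreducible n (a : diagram n) : bool :=
  diagram_ker a == [set: 'I_n * 'I_n].

Definition e n (S : {set diagram n}) : nat := #|[set a in S | diagram_mul a a == a]|.

Definition c n (S : {set diagram n}) : nat :=
  #|[set a in S | irreducible a && (diagram_mul a a == a)]|.

Definition is_intpart (n : nat) (s : seq nat) : bool :=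
  [&& sorted geq s, 0 \notin s & sumn s == n].

(* Integer partitions of n, as non-increasing sequences of positive parts. To
   make them a finite type, the length and the parts are bounded by n, which
   excludes nothing: see [intpart_complete]. *)
Record intpart (n : nat) := IntPart {
  parts_bseq : n.-bseq 'I_n.+1;
  parts_bseqP : is_intpart n [seq val p | p <- parts_bseq]
}.

HB.instance Definition _ n := [isSub for @parts_bseq n].
HB.instance Definition _ n := [Finite of intpart n by <:].

Definition parts n (mu : intpart n) : seq nat :=
  [seq val p | p <- parts_bseq mu].

Definition mult n (mu : intpart n) (i : nat) : nat := count_mem i (parts mu).

Lemma intpart_complete n s : is_intpart n s -> exists mu : intpart n, parts mu = s.
Proof.
move=> sP; have /and3P[_ s_gt0 /eqP s_sum] := sP.
have s_le : all (fun p => p < n.+1) s.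
  rewrite -s_sum; apply/allP => p; rewrite ltnS.
  elim: s {sP s_gt0 s_sum} => //= q s IHs.
  rewrite inE => /predU1P[-> | /IHs]; first exact: leq_addr.
  by move=> le_p; apply: leq_trans le_p (leq_addl _ _).
have s_size : size s <= n.
  rewrite -s_sum; elim: s {sP s_le s_sum} s_gt0 => //= q s IHs.
  rewrite inE negb_or eq_sym -lt0n => /andP[q_gt0 /IHs].
  by rewrite -add1n; apply: leq_add.
have sE : [seq val p | p <- [seq inord p : 'I_n.+1 | p <- s]] = s.
  rewrite -map_comp -[RHS]map_id; apply/eq_in_map => p /(allP s_le) lt_p /=.
  by rewrite inordK.
have t_size : size [seq inord p : 'I_n.+1 | p <- s] <= n by rewrite size_map.
have tP : is_intpart n [seq val p | p <- Bseq t_size] by rewrite /= sE.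
by exists (IntPart tP); rewrite /parts /= sE.
Qed.

(* Main.v *)
Require Import Defs.
From mathcomp Require Import all_boot all_order all_algebra.
From mathcomp Require Import ring.
Import Order.TTheory GRing.Theory Num.Theory.

Set Implicit Arguments.
Unset Strict Implicit.
Unset Printing Implicit Defensive.

(** An idempotent is the disjoint union of irreducible idempotents, one on each
    class of its kernel; everything else is counting.

    The three families are treated at once: each consists of the partitions
    whose block sizes satisfy a predicate [ok] (no condition, size 2, size at
    most 2), and a condition on blocks is inherited by, and can be checked on,
    the pieces of a disjoint union.

    The key point is [diagram_mul_id], which replaces the equation a a = a by a
    local condition that does not mention the product: whenever an upper x and
    a lower y' are in the same block, x and y are related by the kernel, and a
    kernel class meets at most one block that contains both upper and lower
    vertices.  This holds because in the product graph of a with itself the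
    middle row carries exactly the graph generating the kernel; under the local
    condition, a component of the product graph meets the outer rows either in a
    non-transversal block or in the one transversal block of a kernel class.  By the local condition every
    block lies over one kernel class, and both the kernel and the condition can
    be computed class by class ([kernel_union], [locally_idempotent_union]).

    Hence, an idempotent on a nonempty set is determined by the kernel class A
    of a base point, an irreducible idempotent over A, and an arbitrary
    idempotent over the complement of A ([card_idempotents]).  The last two
    numbers depend on #|A| only, and there are binomial (n - 1, m - 1) sets A of
    size m through the base point; this is the recurrence.

    The closed formula follows from the recurrence alone
    ([exponential_formula]).  In terms of exponential generating series the
    recurrence is E' = C' E and the formula is E = exp C.  Concretely, with
    x_i = c_i / i!, the sum F_n over the partitions mu of n of the products of
    x_i ^ mu_i / mu_i! satisfies n F_n = sum_m m x_m F_(n - m): write n as the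
    sum of the m mu_m and remove one part m from mu.  The numbers e_n / n!
    satisfy the same recurrence. *)

(** * Partitions of sets and connectivity *)

Section Auxiliary.

Variable T : finType.

Lemma partition_setU (P Q : {set {set T}}) (D E : {set T}) :
  partition P D -> partition Q E -> [disjoint D & E] ->
  partition (P :|: Q) (D :|: E).
Proof.
move=> /and3P[/eqP covP triP P0] /and3P[/eqP covQ triQ Q0] disDE.
apply/and3P; split; last by rewrite inE (negPf P0) (negPf Q0).
  by rewrite /cover bigcup_setU -/(cover P) -/(cover Q) covP covQ.
by apply: trivIsetU; rewrite // covP covQ.
Qed.

Lemma partition_restrict (P : {set {set T}}) (D E : {set T}) :
    partition P D -> E \subset D ->
    {in P, forall B : {set T}, {in B &, forall u v, u \in E -> v \in E}} ->
  partition (P ::&: E) E.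
Proof.
move=> partP sED satE; have /and3P[/eqP covP triP P0] := partP.
apply/and3P; split; last by rewrite inE (negPf P0).
  rewrite eqEsubset; apply/andP; split.
    by apply/bigcupsP => B; rewrite inE => /andP[].
  apply/subsetP => u Eu; have Du := subsetP sED u Eu.
  have Pu : pblock P u \in P by rewrite pblock_mem ?covP.
  have uu : u \in pblock P u by rewrite mem_pblock covP.
  apply/bigcupP; exists (pblock P u); rewrite // inE Pu /=.
  by apply/subsetP => v uv; apply: (satE _ Pu u).
by apply: trivIsetS triP; apply/subsetP => B; rewrite inE => /andP[].
Qed.

(** Connectivity from a point is decided inside any set containing it that no
    edge of the second relation leaves. *)
Lemma connect_closed (r1 r2 : rel T) (A : {set T}) x :
    {in A, r1 =2 r2} -> (forall y z, r2 y z -> y \in A -> z \in A) ->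
  x \in A -> connect r1 x =1 connect r2 x.
Proof.
move=> r12 Acl Ax y; apply/connectP/connectP => -[p pth ->]; exists p => //.
  elim: p x Ax pth => //= z p IHp x Ax /andP[]; rewrite r12 // => rxz.
  by rewrite rxz; apply: IHp; apply: Acl rxz Ax.
elim: p x Ax pth => //= z p IHp x Ax /andP[]; rewrite r12 // => rxz.
by rewrite rxz; apply: IHp; apply: Acl rxz Ax.
Qed.

Lemma connect_mem (r : rel T) (A : {set T}) x y :
    (forall y z, r y z -> y \in A -> z \in A) ->
  connect r x y -> x \in A -> y \in A.
Proof.
move=> Acl /connectP[p pth ->]; elim: p x pth => //= z p IHp x /andP[rxz pth].
by move=> Ax; apply: IHp pth (Acl _ _ rxz Ax).
Qed.

End Auxiliary.

(** * Local description of idempotents *)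

Section Blocks.

Variable T : finType.
Implicit Types (P : {set {set T + T}}) (A : {set T}) (u v : (T + T)%type).

Definition base u : T := match u with inl x => x | inr x => x end.

Definition over A : {set T + T} := [set u | base u \in A].

Definition same_block P : rel (T + T) :=
  fun u v => [exists B in P, (u \in B) && (v \in B)].

(** On a diagram, this generates the join of the upper and the lower kernel. *)
Definition row_edge P : rel T := fun x y =>
  same_block P (inl x) (inl y) || same_block P (inr x) (inr y).

Definition kernel P : rel T := connect (row_edge P).

(** For diagrams this is equivalent to idempotency ([diagram_mul_id]); unlike
    the product, it makes sense for blocks covering only part of the vertices,
    and it visibly decomposes along the kernel. *)
Definition locally_idempotent P : bool :=
  [forall x, forall y, same_block P (inl x) (inr y) ==>
     kernel P x y &&
     [forall z, forall w, same_block P (inl z) (inr w) ==>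
        kernel P x z ==> same_block P (inl x) (inl z)]].

Lemma locally_idempotentP P :
  reflect (forall x y, same_block P (inl x) (inr y) ->
             kernel P x y /\
             forall z w, same_block P (inl z) (inr w) ->
               kernel P x z -> same_block P (inl x) (inl z))
          (locally_idempotent P).
Proof.
apply: (iffP forallP) => [idP x y xy | idP x].
  have /forallP/(_ y)/implyP/(_ xy)/andP[kxy /forallP tr] := idP x.
  split=> // z w zw kxz.
  by have /forallP/(_ w)/implyP/(_ zw)/implyP/(_ kxz) := tr z.
apply/forallP => y; apply/implyP => /idP[-> tr] /=.
apply/forallP => z; apply/forallP => w; apply/implyP => zw; apply/implyP.
exact: tr zw.
Qed.

(** Idempotents supported on A are kept as families of blocks over the ambient
    type T, so that two of them with complementary supports have a plain union. *)
Definition idempotents (ok : pred nat) A : {set {set {set T + T}}} :=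
  [set P | [&& partition P (over A), [forall B in P, ok #|B|] &
               locally_idempotent P]].

Definition irreducible_idempotents (ok : pred nat) A :=
  [set P in idempotents ok A | [forall x in A, forall y in A, kernel P x y]].

Lemma same_blockP P u v :
  reflect (exists B, [/\ B \in P, u \in B & v \in B]) (same_block P u v).
Proof.
apply: (iffP existsP) => -[B]; first by case/and3P; exists B.
by case=> PB Bu Bv; exists B; rewrite PB Bu Bv.
Qed.

Lemma mem_same_block P (B : {set T + T}) u v :
  B \in P -> u \in B -> v \in B -> same_block P u v.
Proof. by move=> PB Bu Bv; apply/same_blockP; exists B. Qed.

Lemma same_block_sym P : symmetric (same_block P).
Proof.
by move=> u v; apply: eq_existsb => B; rewrite [in X in _ && X]andbC.
Qed.

Lemma same_block_trans P : trivIset P -> transitive (same_block P).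
Proof.
move=> triP v u w /same_blockP[B [PB Bu Bv]] /same_blockP[C [PC Cv Cw]].
apply/same_blockP; exists B; split=> //.
by rewrite -(def_pblock triP PB Bv) (def_pblock triP PC Cv).
Qed.

Lemma same_block_pblock P D u v :
  partition P D -> u \in D -> same_block P u v = (v \in pblock P u).
Proof.
move=> /and3P[/eqP covP triP _] Du; apply/same_blockP/idP => [[B []]|uv].
  by move=> PB Bu; rewrite (def_pblock triP PB Bu).
by exists (pblock P u); rewrite pblock_mem ?mem_pblock covP.
Qed.

Lemma same_block_mem P D u v : partition P D -> same_block P u v -> u \in D.
Proof.
move=> /and3P[/eqP <- _ _] /same_blockP[B [PB Bu _]].
by apply/bigcupP; exists B.
Qed.

Lemma row_edge_sym P : symmetric (row_edge P).
Proof. by move=> x y; congr (_ || _); apply: same_block_sym. Qed.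

Lemma kernel_sym P : symmetric (kernel P).
Proof. by move=> x y; apply: sym_connect_sym (row_edge_sym P) x y. Qed.

Lemma kernel_refl P : reflexive (kernel P).
Proof. exact: connect0. Qed.

Lemma kernel_trans P : transitive (kernel P).
Proof. exact: connect_trans. Qed.

Lemma row_edge_mem P A x y :
  partition P (over A) -> row_edge P x y -> x \in A.
Proof.
by move=> partP /orP[] /(same_block_mem partP); rewrite inE.
Qed.

Lemma kernel_mem P A x y :
  partition P (over A) -> kernel P x y -> x \in A -> y \in A.
Proof.
move=> partP; apply: connect_mem => z w.
by rewrite row_edge_sym => /(row_edge_mem partP).
Qed.

(** For idempotents a block lies over a single kernel class, even if it joins the
    two rows. *)
Lemma kernel_base P u v : locally_idempotent P ->
  same_block P u v -> kernel P (base u) (base v).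
Proof.
move=> /locally_idempotentP idP; case: u v => [x|x] [y|y] /= uv.
- by apply: connect1; rewrite /row_edge uv.
- by have [] := idP _ _ uv.
- by rewrite kernel_sym; rewrite same_block_sym in uv; have [] := idP _ _ uv.
- by apply: connect1; rewrite /row_edge uv orbT.
Qed.

Lemma over_setC A : over (~: A) = ~: over A.
Proof. by apply/setP => u; rewrite !inE. Qed.

(** * Splitting along a kernel class *)

Section Union.

Variables (A : {set T}) (P1 P2 : {set {set T + T}}).
Hypotheses (partP1 : partition P1 (over A)) (partP2 : partition P2 (over (~: A))).

Lemma partition_union : partition (P1 :|: P2) (over setT).
Proof.
have -> : over setT = over A :|: over (~: A).
  by rewrite over_setC setUCr; apply/setP => u; rewrite !inE.
by apply: partition_setU; rewrite // over_setC -setI_eq0 setICr.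
Qed.

Lemma same_block_union u v : base u \in A ->
  same_block (P1 :|: P2) u v = same_block P1 u v.
Proof.
move=> Au; apply/same_blockP/same_blockP => -[B [PB Bu Bv]]; exists B; split=> //.
  move: PB; rewrite inE => /orP[//|PB].
  have /(same_block_mem partP2) : same_block P2 u v by apply: mem_same_block Bv.
  by rewrite !inE Au.
by rewrite inE PB.
Qed.

Lemma kernel_union x : x \in A -> kernel (P1 :|: P2) x =1 kernel P1 x.
Proof.
apply: connect_closed => [y Ay z | y z].
  by rewrite /row_edge !same_block_union.
by rewrite row_edge_sym => /(row_edge_mem partP1).
Qed.

Lemma restrict_union : (P1 :|: P2) ::&: over A = P1.
Proof.
apply/setP => B; rewrite !inE; apply/andP/idP => [[/orP[//|PB] sB] | PB].
  have /and3P[/eqP cov2 _ P0] := partP2.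
  have /set0Pn[u Bu] : B != set0 by apply: contraNneq P0 => <-.
  have : u \in over (~: A) by rewrite -cov2; apply/bigcupP; exists B.
  by move: (subsetP sB u Bu); rewrite !inE => ->.
split; first by rewrite PB.
by have /and3P[/eqP <- _ _] := partP1; apply: bigcup_sup.
Qed.

End Union.

Section UnionIdempotent.

Variables (A : {set T}) (P1 P2 : {set {set T + T}}).
Hypotheses (partP1 : partition P1 (over A)) (partP2 : partition P2 (over (~: A))).

Let partP1' : partition P1 (over (~: ~: A)). Proof. by rewrite setCK. Qed.

(** Two pieces of a union do not interact: a block, hence also a kernel path,
    that starts over A stays over A. *)
Lemma locally_idempotent_union :
  locally_idempotent (P1 :|: P2) =
  locally_idempotent P1 && locally_idempotent P2.
Proof.
(* Stated for any support B, to be used for A and for its complement. *)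
have half B Q1 Q2 : partition Q1 (over B) -> partition Q2 (over (~: B)) ->
    locally_idempotent (Q1 :|: Q2) -> locally_idempotent Q1.
  move=> pQ1 pQ2 /locally_idempotentP idQ.
  apply/locally_idempotentP => x y xy.
  have Bx : x \in B by have := same_block_mem pQ1 xy; rewrite inE.
  have [] := idQ x y; first by rewrite (same_block_union _ pQ2).
  rewrite (kernel_union pQ1 pQ2) // => kxy tr; split=> // z w zw kxz.
  have Bz : z \in B by have := same_block_mem pQ1 zw; rewrite inE.
  rewrite -(same_block_union _ pQ2) //; apply: (tr z w).
    by rewrite (same_block_union _ pQ2).
  by rewrite (kernel_union pQ1 pQ2).
have glue B Q1 Q2 x y : partition Q1 (over B) -> partition Q2 (over (~: B)) ->
    locally_idempotent Q1 -> x \in B -> same_block (Q1 :|: Q2) (inl x) (inr y) ->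
    kernel (Q1 :|: Q2) x y /\
    forall z w, same_block (Q1 :|: Q2) (inl z) (inr w) ->
      kernel (Q1 :|: Q2) x z -> same_block (Q1 :|: Q2) (inl x) (inl z).
  move=> pQ1 pQ2 /locally_idempotentP idQ Bx.
  rewrite (same_block_union _ pQ2) // => xy; have [kxy tr] := idQ _ _ xy.
  rewrite (kernel_union pQ1 pQ2) //; split=> // z w zw.
  rewrite (kernel_union pQ1 pQ2) // => kxz.
  rewrite (same_block_union _ pQ2) //; apply: (tr z w) => //.
  by rewrite -(same_block_union _ pQ2) //; exact: (kernel_mem pQ1 kxz Bx).
apply/idP/andP => [idP | [id1 id2]].
  split; first exact: (half A P1 P2).
  by apply: (half (~: A) P2 P1 partP2 partP1'); rewrite setUC.
apply/locally_idempotentP => x y; have [Ax|nAx] := boolP (x \in A).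
  exact: (glue A).
by rewrite setUC; apply: (glue (~: A)); rewrite // inE.
Qed.

End UnionIdempotent.

Definition kernel_class x0 P : {set T} := [set y | kernel P x0 y].

(** The bijection (P1, P2) |-> P1 :|: P2; its inverse restricts P to the blocks
    over A and over the complement of A.  The first factor is irreducible
    exactly because A is a whole kernel class. *)
Lemma card_idempotents_class ok A x0 : x0 \in A ->
  #|[set P in idempotents ok setT | kernel_class x0 P == A]| =
  #|irreducible_idempotents ok A| * #|idempotents ok (~: A)|.
Proof.
move=> Ax0; rewrite -cardsX.
set D := setX _ _; pose U (X : {set {set T + T}} * {set {set T + T}}) := X.1 :|: X.2.
have injU : {in D &, injective U}.
  have restr X : X \in D ->
      (U X ::&: over A, U X ::&: over (~: A)) = X.
    case: X => P1 P2; rewrite !inE => /andP[/andP[/and3P[part1 _ _] _] /and3P[part2 _ _]].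
    congr (_, _); first exact: (restrict_union part1 part2).
    rewrite /U /= setUC; apply: (@restrict_union (~: A)); rewrite ?setCK //.
  by move=> X Y DX DY eqXY; rewrite -(restr X DX) -(restr Y DY) eqXY.
rewrite -(card_in_imset injU); congr #|pred_of_set _|; apply/setP => P.
apply/idP/imsetP => [|[[P1 P2]]].
  rewrite !inE => /andP[/and3P[partP okP idP] /eqP clA].
  have sat B : B \in P ->
      {in B &, forall u v, (base u \in A) = (base v \in A)}.
    move=> PB u v Bu Bv; rewrite -clA !inE.
    have kuv : kernel P (base u) (base v).
      by apply: kernel_base => //; apply: mem_same_block Bv.
    exact: (same_connect_r (sym_connect_sym (row_edge_sym P)) kuv).
  pose P1 := P ::&: over A; pose P2 := P ::&: over (~: A).
  have ovT C : over C \subset over setT by apply/subsetP => u; rewrite !inE.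
  have part1 : partition P1 (over A).
    apply: partition_restrict partP _ _ => // B PB u v Bu Bv.
    by rewrite !inE (sat B PB u v).
  have part2 : partition P2 (over (~: A)).
    apply: partition_restrict partP _ _ => // B PB u v Bu Bv.
    by rewrite !inE (sat B PB u v).
  have defP : P = P1 :|: P2.
    apply/setP => B; rewrite !inE -andb_orr; have [PB|//] := boolP (B \in P).
    have /and3P[_ _ P0] := partP.
    have /set0Pn[u Bu] : B != set0 by apply: contraNneq P0 => <-.
    symmetry; apply/orP; have [Au|nAu] := boolP (base u \in A).
      by left; apply/subsetP => v Bv; rewrite inE -(sat B PB u v).
    by right; apply/subsetP => v Bv; rewrite !inE -(sat B PB u v).
  have := idP; rewrite {1}defP (locally_idempotent_union part1 part2) => /andP[id1 id2].
  exists (P1, P2); last exact: defP.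
  have okR C : [forall B in P ::&: over C, ok #|B|].
    by apply/forall_inP => B; rewrite inE => /andP[/(forall_inP okP)].
  rewrite !inE /= part1 part2 id1 id2 !okR /= andbT.
  apply/forall_inP => x Ax; apply/forall_inP => y Ay.
  rewrite -(kernel_union part1 part2) // -defP.
  apply: (kernel_trans (y := x0)); last by move: Ay; rewrite -clA inE.
  by rewrite kernel_sym; move: Ax; rewrite -clA inE.
rewrite !inE /= => /andP[/andP[/and3P[part1 ok1 id1] irr1] /and3P[part2 ok2 id2]] ->.
rewrite /U /= (partition_union part1 part2).
rewrite (locally_idempotent_union part1 part2) id1 id2 !andbT.
apply/andP; split.
  by apply/forall_inP => B; rewrite inE => /orP[/(forall_inP ok1)|/(forall_inP ok2)].
apply/eqP/setP => y; rewrite inE (kernel_union part1 part2) //.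
apply/idP/idP => [kxy | Ay]; first exact: kernel_mem kxy Ax0.
by move/forall_inP: irr1 => /(_ x0 Ax0)/forall_inP; apply.
Qed.

Lemma card_idempotents ok x0 :
  #|idempotents ok setT| =
  \sum_(A : {set T} | x0 \in A)
     #|irreducible_idempotents ok A| * #|idempotents ok (~: A)|.
Proof.
rewrite -sum1_card (partition_big (kernel_class x0) [pred A : {set T} | x0 \in A]) /=.
  apply: eq_bigr => A Ax0; rewrite sum1dep_card -(card_idempotents_class ok Ax0).
  by apply: eq_card => P; rewrite !inE.
by move=> P _; rewrite inE; apply: kernel_refl.
Qed.

End Blocks.

(** * Invariance under relabelling *)

Section Relabelling.

Variables (S T : finType) (f : S -> T).
Hypothesis injf : injective f.
Implicit Types (P : {set {set S + S}}) (A : {set S}).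

Definition relabel (u : (S + S)%type) : (T + T)%type :=
  match u with inl x => inl (f x) | inr x => inr (f x) end.

Definition relabel_blocks P : {set {set T + T}} :=
  [set relabel @: B | B : {set S + S} in P].

Lemma relabel_inj : injective relabel.
Proof. by move=> [x|x] [y|y] //= [/injf->]. Qed.

Lemma relabel_over A : relabel @: over A = over (f @: A).
Proof.
apply/setP => u; apply/imsetP/idP => [[v Av ->]|].
  by rewrite inE; case: v Av => x; rewrite inE /= => Ax; apply: imset_f.
rewrite inE; case: u => y /= /imsetP[x Ax ->]; [exists (inl x) | exists (inr x)];
  by rewrite // inE.
Qed.

Lemma same_block_relabel P u v :
  same_block (relabel_blocks P) (relabel u) (relabel v) = same_block P u v.
Proof.
apply/same_blockP/same_blockP => [[_ [/imsetP[B PB ->]]] | [B [PB Bu Bv]]].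
  by rewrite !(mem_imset _ _ relabel_inj); exists B.
by exists (relabel @: B); rewrite !imset_f.
Qed.

Lemma same_block_relabelP P u v : same_block (relabel_blocks P) u v ->
  exists u' v', [/\ u = relabel u', v = relabel v' & same_block P u' v'].
Proof.
case/same_blockP=> _ [/imsetP[B PB ->] /imsetP[u' Bu ->] /imsetP[v' Bv ->]].
by exists u', v'; split=> //; apply/same_blockP; exists B.
Qed.

Lemma row_edge_relabel P x y :
  row_edge (relabel_blocks P) (f x) (f y) = row_edge P x y.
Proof.
by rewrite /row_edge -!(same_block_relabel P).
Qed.

Lemma row_edge_relabelP P x z : row_edge (relabel_blocks P) (f x) z ->
  exists y, z = f y.
Proof.
by case/orP=> /same_block_relabelP[_ [[y|y] [_ // [->] _]]]; exists y.
Qed.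

Lemma kernel_relabel P x y :
  kernel (relabel_blocks P) (f x) (f y) = kernel P x y.
Proof.
apply/connectP/connectP => -[p].
  elim: p x => [|z p IHp] x /=; first by move=> _ /injf->; exists [::].
  case/andP=> xz; have [w zw] := row_edge_relabelP xz; rewrite {}zw in xz *.
  move=> pth /(IHp _ pth)[q wq ->]; exists (w :: q) => //=.
  by rewrite wq -row_edge_relabel xz.
move=> pth ->; exists (map f p); last by rewrite last_map.
by rewrite path_map (eq_path (@row_edge_relabel P)).
Qed.

Lemma locally_idempotent_relabel P :
  locally_idempotent (relabel_blocks P) = locally_idempotent P.
Proof.
apply/locally_idempotentP/locally_idempotentP => idP x y.
  rewrite -(same_block_relabel P) => /idP[]; rewrite kernel_relabel => kxy tr.
  split=> // z w; rewrite -(same_block_relabel P) -kernel_relabel => zw kxz.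
  by rewrite -(same_block_relabel P); apply: tr zw kxz.
case/same_block_relabelP=> -[x'|x'] [] [y'|y'] [] // [->] [->].
case/idP=> kxy tr; rewrite kernel_relabel; split=> // z w.
case/same_block_relabelP=> -[z'|z'] [] [w'|w'] [] // [->] _ zw.
by rewrite kernel_relabel => kxz; move: (tr _ _ zw kxz); rewrite -(same_block_relabel P).
Qed.

Lemma relabel_blocks_inj : injective relabel_blocks.
Proof. exact/imset_inj/imset_inj/relabel_inj. Qed.

Lemma relabel_blocks_idempotents ok A P :
  (relabel_blocks P \in idempotents ok (f @: A)) = (P \in idempotents ok A).
Proof.
rewrite !inE -relabel_over imset_partition; last exact: relabel_inj.
rewrite locally_idempotent_relabel; congr [&& _, _ & _].
apply/forall_inP/forall_inP => okP B.
  by move=> PB; rewrite -(card_imset _ relabel_inj); apply: okP; apply: imset_f.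
by case/imsetP=> C PC ->; rewrite (card_imset _ relabel_inj); apply: okP.
Qed.

Lemma relabel_blocks_irreducible_idempotents ok A P :
  (relabel_blocks P \in irreducible_idempotents ok (f @: A)) =
  (P \in irreducible_idempotents ok A).
Proof.
rewrite in_set relabel_blocks_idempotents [in RHS]in_set; congr (_ && _).
apply/forall_inP/forall_inP => irrP x.
  move=> Ax; apply/forall_inP => y Ay; rewrite -kernel_relabel.
  by apply: (forall_inP (irrP _ _)); apply: imset_f.
case/imsetP=> x' Ax ->; apply/forall_inP => y /imsetP[y' Ay ->].
by rewrite kernel_relabel; apply: (forall_inP (irrP _ _)).
Qed.

Lemma relabel_blocks_onto A (Q : {set {set T + T}}) :
  partition Q (over (f @: A)) -> exists P, Q = relabel_blocks P.
Proof.
move=> /and3P[/eqP covQ _ _]; exists [set relabel @^-1: B | B : {set T + T} in Q].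
rewrite /relabel_blocks -imset_comp -[LHS]imset_id; apply: eq_in_imset => B QB /=.
apply/setP => u; apply/idP/imsetP => [Bu | [v]]; last by rewrite inE => Bv ->.
have : u \in relabel @: over A.
  by rewrite relabel_over -covQ; apply/bigcupP; exists B.
by case/imsetP=> v _ uv; exists v; rewrite // inE -uv.
Qed.

Lemma card_idempotents_relabel ok A :
  #|idempotents ok (f @: A)| = #|idempotents ok A|.
Proof.
rewrite -(card_imset _ relabel_blocks_inj); apply: eq_card => Q.
apply/idP/imsetP => [idQ | [P idP ->]]; last by rewrite relabel_blocks_idempotents.
have [P defQ] : exists P, Q = relabel_blocks P.
  by apply: (@relabel_blocks_onto A); move: idQ; rewrite inE => /andP[].
by exists P; rewrite // -(relabel_blocks_idempotents ok) -defQ.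
Qed.

Lemma card_irreducible_idempotents_relabel ok A :
  #|irreducible_idempotents ok (f @: A)| = #|irreducible_idempotents ok A|.
Proof.
rewrite -(card_imset _ relabel_blocks_inj); apply: eq_card => Q.
apply/idP/imsetP => [irrQ | [P irrP ->]].
  have [P defQ] : exists P, Q = relabel_blocks P.
    by apply: (@relabel_blocks_onto A); move: irrQ; rewrite !inE => /andP[/andP[]].
  by exists P; rewrite // -(relabel_blocks_irreducible_idempotents ok) -defQ.
by rewrite relabel_blocks_irreducible_idempotents.
Qed.

End Relabelling.

Section CardinalOnly.

Variables (T : finType) (A : {set T}) (ok : pred nat).

Lemma enum_val_image : @enum_val _ (mem A) @: [set: 'I_#|A|] = A.
Proof.
apply/setP => x; apply/imsetP/idP => [[i _ ->] | Ax]; first exact: enum_valP.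
by exists (enum_rank_in Ax x); rewrite ?enum_rankK_in.
Qed.

Lemma card_idempotents_ord :
  #|idempotents ok A| = #|idempotents ok [set: 'I_#|A|]|.
Proof.
by rewrite -(card_idempotents_relabel (@enum_val_inj _ (mem A))) enum_val_image.
Qed.

Lemma card_irreducible_idempotents_ord :
  #|irreducible_idempotents ok A| = #|irreducible_idempotents ok [set: 'I_#|A|]|.
Proof.
rewrite -(card_irreducible_idempotents_relabel (@enum_val_inj _ (mem A))).
by rewrite enum_val_image.
Qed.

End CardinalOnly.

(** * Idempotent diagrams *)

Definition diagrams (ok : pred nat) n : {set diagram n} :=
  [set a : diagram n | [forall B in blocks a, ok #|B|]].

Section Diagram.

Variable n : nat.
Implicit Type a : diagram n.

Lemma over_setT (T : finType) : over [set: T] = [set: T + T].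
Proof. by apply/setP => u; rewrite !inE. Qed.

Lemma same_block_refl a u : same_block a u u.
Proof.
have partP := blocksP a.
rewrite (same_block_pblock _ partP) ?inE // mem_pblock.
by case/and3P: partP => /eqP-> _ _; rewrite inE.
Qed.

Lemma block_trans a u v w :
  same_block a u v -> same_block a v w -> same_block a u w.
Proof. exact/same_block_trans/partition_trivIset/blocksP. Qed.

Lemma diagram_mul_idE a :
  (diagram_mul a a == a) = [forall u, forall v, joined a a u v == same_block a u v].
Proof.
have partP := blocksP a; rewrite -val_eqE /=.
apply/eqP/forallP => [mulE u | joinE].
  apply/forallP => v; apply/eqP.
  rewrite -(pblock_equivalence_partition (@joined_equiv n a a)) ?inE // mulE.
  by rewrite (same_block_pblock _ partP) ?inE.
rewrite -[RHS](equivalence_partition_pblock partP).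
apply: eq_imset => u; apply/setP => v; rewrite !inE /=.
by have /forallP/(_ v)/eqP-> := joinE u; rewrite (same_block_pblock _ partP) ?inE.
Qed.

Lemma product_graph_lower a u v :
  same_block a u v -> product_graph a a (relabel_lower u) (relabel_lower v).
Proof.
case/same_blockP=> B [PB Bu Bv]; apply/orP; left; apply/existsP; exists B.
by rewrite PB !imset_f.
Qed.

Lemma product_graph_upper a u v :
  same_block a u v -> product_graph a a (relabel_upper u) (relabel_upper v).
Proof.
case/same_blockP=> B [PB Bu Bv]; apply/orP; right; apply/existsP; exists B.
by rewrite PB !imset_f.
Qed.

(** The edges between middle vertices are the lower blocks of the first factor
    and the upper blocks of the second. *)
Lemma connect_kernel a x y : kernel a x y ->
  connect (product_graph a a) (inr x) (inr y).
Proof.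
case/connectP=> p + ->; elim: p x => //= z p IHp x /andP[xz /IHp].
apply: connect_trans; apply: connect1; case/orP: xz.
  exact: product_graph_upper.
exact: product_graph_lower.
Qed.

(** A block joining x to y' survives in the square: go from x to y'', along the
    kernel from y'' to x'', and from x'' to y'. *)
Lemma joined_same_block a u v :
  locally_idempotent a -> same_block a u v -> joined a a u v.
Proof.
move=> /locally_idempotentP ida.
have cross x y : same_block a (inl x) (inr y) -> joined a a (inl x) (inr y).
  move=> xy; have [kxy _] := ida _ _ xy.
  apply: (connect_trans (connect1 (product_graph_lower xy))).
  rewrite /= kernel_sym in kxy *; apply: (connect_trans (connect_kernel kxy)).
  exact: connect1 (product_graph_upper xy).
case: u v => [x|x] [y|y] uv.
- exact: connect1 (product_graph_lower uv).
- exact: cross.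
- rewrite /joined (sym_connect_sym (product_graph_sym a a)); apply: cross.
  by rewrite same_block_sym.
- exact: connect1 (product_graph_upper uv).
Qed.

Definition transversal a (u : vertex n) : bool :=
  [exists x, exists y, same_block a u (inl x) && same_block a u (inr y)].

(** The intended component of u in the product graph of a with itself: the block
    of u on the outer rows and, if that block is transversal, the kernel class of
    u on the middle row.  Being closed ([component_closed]), it contains the
    component of u, which is all that is needed to bound the square by a. *)
Definition component a (u : vertex n) : {set vertex3 n} :=
  [set w | match w with
           | inl v => same_block a u v
           | inr y => transversal a u && kernel a (base u) y
           end].

Lemma component_closed a u w1 w2 : locally_idempotent a ->
  product_graph a a w1 w2 -> w1 \in component a u -> w2 \in component a u.
Proof.
move=> ida; have /locally_idempotentP idP := ida.
(* A kernel class carries only one transversal block: that of u is the one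
   through x and y'. *)
have cross x y : transversal a u -> kernel a (base u) x ->
    same_block a (inl x) (inr y) -> same_block a u (inl x).
  case/existsP=> z /existsP[w /andP[uz uw]] kux xy.
  apply: (block_trans uz); have zw : same_block a (inl z) (inr w).
    by apply: (block_trans _ uw); rewrite same_block_sym.
  have [_] := idP _ _ zw; apply; first exact: xy.
  apply: kernel_trans kux.
  by apply: (kernel_base (u := inl z) ida); rewrite same_block_sym.
have arrive x y v : same_block a (inl x) (inr y) -> same_block a u v ->
    (v = inl x \/ v = inr y) -> transversal a u.
  move=> xy uv vE; apply/existsP; exists x; apply/existsP; exists y.
  case: vE uv => -> uv; rewrite uv ?andbT /=; first exact: (block_trans uv xy).
  by apply: (block_trans uv); rewrite same_block_sym.
case/orP=> /existsP[B /and3P[PB /imsetP[p Bp ->] /imsetP[q Bq ->]]];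
  have pq := mem_same_block PB Bp Bq; rewrite !inE; case: p q pq {Bp Bq} => x [] y xy /=.
- by move=> ux; apply: (block_trans _ xy).
- move=> ux; rewrite (arrive x y (inl x)) //; last by left.
  apply: (kernel_base (v := inr y) ida); exact: block_trans xy.
- rewrite same_block_sym in xy; case/andP=> tu kux.
  have kuy : kernel a (base u) y.
    by apply: (kernel_trans kux); rewrite kernel_sym; case: (idP _ _ xy).
  exact: cross xy.
- case/andP=> -> kux; apply: (kernel_trans kux); apply: connect1.
  by rewrite /row_edge xy orbT.
- case/andP=> -> kux; apply: (kernel_trans kux); apply: connect1.
  by rewrite /row_edge xy.
- by case/andP=> tu kux; apply: (block_trans _ xy); apply: cross xy.
- rewrite same_block_sym in xy; move=> ux; rewrite (arrive y x (inr x)) //; last by right.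
  apply: (kernel_base (v := inl y) ida); apply: (block_trans ux).
  by rewrite same_block_sym.
- by move=> ux; apply: (block_trans _ xy).
Qed.

(** Assume conversely that a is idempotent.  If x and y' share a block, a path
    from x to y' in the product graph leaves the set of upper vertices and of
    middle vertices z'' with z in the kernel class of some z1 such that z1' is
    in the block of x.  It does so at a middle vertex z'' whose upper copy z is
    in the block of some reachable v'.  By idempotency every outer vertex that
    is reached lies in the block of x, so x, z, z1 and y are kernel related.
    Uniqueness of the transversal block of a kernel class is the existence of a
    path through the middle row. *)
Lemma diagram_mul_id a : (diagram_mul a a == a) = locally_idempotent a.
Proof.
rewrite diagram_mul_idE; apply/forallP/idP => [joinE | ida u]; last first.
  apply/forallP => v; apply/eqP; apply/idP/idP; last exact: joined_same_block.
  move/(connect_mem (fun w1 w2 => @component_closed a u w1 w2 ida)).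
  by rewrite !inE same_block_refl => /(_ isT).
have {}joinE u v : joined a a u v = same_block a u v.
  by have /forallP/(_ v)/eqP := joinE u.
have kxy x y : same_block a (inl x) (inr y) -> kernel a x y.
  move=> xy; apply: contraTT (xy) => nkxy; apply/negP.
  (* [Z] is the part reached from [s] before the lower row. *)
  pose s : vertex3 n := inl (inl x).
  pose Z : {set vertex3 n} :=
    [set w | connect (product_graph a a) s w &&
       match w with
       | inl (inl v) => true
       | inl (inr v) => false
       | inr z => [exists z1, same_block a (inl x) (inr z1) && kernel a z1 z]
       end].
  rewrite -joinE => /(@connect_mem _ _ Z); rewrite !inE connect0 /= andbF.
  suff cl w1 w2 : product_graph a a w1 w2 -> w1 \in Z -> w2 \in Z by move/(_ cl isT).
  move=> w12; rewrite !inE => /andP[sw1].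
  have sw2 := connect_trans sw1 (connect1 w12); rewrite sw2 /=.
  have inB v : connect (product_graph a a) s (inl v) -> same_block a (inl x) v.
    by rewrite -joinE.
  case/orP: w12 => /existsP[B /and3P[PB /imsetP[p Bp w1E] /imsetP[q Bq w2E]]];
  have pq := mem_same_block PB Bp Bq; subst w1 w2;
  case: p q pq {Bp Bq} sw1 sw2 => p [] q pq //= sw1 sw2.
  - move=> _; apply/existsP; exists q; rewrite kernel_refl andbT.
    exact: block_trans (inB _ sw1) pq.
  - case/existsP=> z1 /andP[xz1 kz1]; apply/existsP; exists z1; rewrite xz1.
    by apply: (kernel_trans kz1); apply: connect1; rewrite /row_edge pq orbT.
  - case/existsP=> z1 /andP[xz1 kz1]; apply/existsP; exists z1; rewrite xz1.
    by apply: (kernel_trans kz1); apply: connect1; rewrite /row_edge pq.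
  (* The edge from the middle vertex p'' down to q' leaves [Z]. *)
  case/existsP=> z1 /andP[xz1 kz1]; case/negP: nkxy.
  have xp : same_block a (inl x) (inl p).
    by apply: (block_trans (inB _ sw2)); rewrite same_block_sym.
  apply: (kernel_trans (y := p)); first by apply: connect1; rewrite /row_edge xp.
  apply: (kernel_trans (y := z1)); first by rewrite kernel_sym.
  apply: connect1; rewrite /row_edge; apply/orP; right.
  by apply: (block_trans _ xy); rewrite same_block_sym.
apply/locally_idempotentP => x y xy; split=> [|z w zw kxz]; first exact: kxy.
rewrite same_block_sym in zw; apply: (block_trans _ zw); rewrite -joinE.
apply: (connect_trans (connect1 (product_graph_lower xy))).
have kyz : kernel a y z.
  by apply: kernel_trans kxz; rewrite kernel_sym; apply: kxy.
apply: (connect_trans (connect_kernel kyz)); apply: connect1.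
by apply: (@product_graph_upper a (inl z) (inr w)); rewrite same_block_sym.
Qed.

Lemma diagram_kerE a : diagram_ker a = [set p | kernel a p.1 p.2].
Proof.
have partP := blocksP a.
have upE : ker_upper a = [set p | same_block a (inl p.1) (inl p.2)].
  by apply/setP => p; rewrite !inE (same_block_pblock _ partP) ?inE.
have loE : ker_lower a = [set p | same_block a (inr p.1) (inr p.2)].
  by apply/setP => p; rewrite !inE (same_block_pblock _ partP) ?inE.
apply/eqP; rewrite eqEsubset; apply/andP; split.
  apply: bigcap_inf; apply/and3P; split; last 2 first.
  - by rewrite upE; apply/subsetP => p; rewrite !inE => xy; apply: connect1; rewrite /row_edge xy.
  - by rewrite loE; apply/subsetP => p; rewrite !inE => xy; apply: connect1; rewrite /row_edge xy orbT.
  apply/and3P; split; apply/forallP => x; first by rewrite inE kernel_refl.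
    by apply/forallP => y; rewrite !inE kernel_sym; apply/implyP.
  apply/forallP => y; apply/forallP => z; rewrite !inE; apply/implyP => /andP[].
  exact: kernel_trans.
apply/subsetP => -[x y]; rewrite inE /= => kxy; apply/bigcapP => E.
case/and3P=> /and3P[/forallP rE _ /forallP tE] /subsetP uE /subsetP lE.
case/connectP: kxy => p + ->; elim: p x => //= z p IHp x /andP[xz /IHp zE].
have /forallP/(_ z)/forallP/(_ (last z p))/implyP := tE x; apply; rewrite zE andbT.
by case/orP: xz => xz; [apply: uE; rewrite upE inE | apply: lE; rewrite loE inE].
Qed.

Lemma irreducibleE a :
  irreducible a = [forall x in setT, forall y in setT, kernel a x y].
Proof.
rewrite /irreducible diagram_kerE; apply/eqP/forall_inP => [kE x _ | kE].
  by apply/forall_inP => y _; have := in_setT (x, y); rewrite -kE inE.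
apply/setP => -[x y]; rewrite !inE /=.
by have /forall_inP/(_ y)-> := kE x (in_setT x).
Qed.

Lemma card_diagrams (p : pred {set {set vertex n}}) :
  #|[set a : diagram n | p (blocks a)]| =
  #|[set P | partition P (over [set: 'I_n]) && p P]|.
Proof.
rewrite -(card_imset _ val_inj) over_setT; apply: eq_card => P.
apply/imsetP/idP => [[a pa ->] | ].
  by move: pa; rewrite !inE blocksP => ->.
by rewrite inE => /andP[partP pP]; exists (Diagram partP); rewrite // inE.
Qed.

Lemma e_diagrams ok : e (diagrams ok n) = #|idempotents ok [set: 'I_n]|.
Proof.
rewrite -card_diagrams; apply: eq_card => a.
by rewrite !inE diagram_mul_id.
Qed.

Lemma c_diagrams ok :
  c (diagrams ok n) = #|irreducible_idempotents ok [set: 'I_n]|.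
Proof.
have -> : irreducible_idempotents ok [set: 'I_n] =
  [set P | partition P (over [set: 'I_n]) &&
     [&& [forall B in P, ok #|B|], locally_idempotent P &
         [forall x in setT, forall y in setT, kernel P x y]]].
  by apply/setP => P; rewrite 3!inE -!andbA.
rewrite -card_diagrams; apply: eq_card => a.
by rewrite !inE diagram_mul_id irreducibleE [X in _ && X]andbC.
Qed.

End Diagram.

Lemma e_diagrams0 ok : e (diagrams ok 0) = 1.
Proof.
rewrite e_diagrams -(cards1 (set0 : {set {set 'I_0 + 'I_0}})).
apply: eq_card => P; rewrite !inE.
have no (B : {set 'I_0 + 'I_0}) : B = set0 by apply/setP => -[] [].
apply/and3P/eqP => [[/and3P[_ _ P0] _ _] | ->].
  by apply/setP => B; rewrite inE (no B) (negPf P0).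
split; first by apply/and3P; rewrite [over _]no inE; split; rewrite // /trivIset /cover !big_set0 ?cards0.
  by apply/forall_inP => B; rewrite inE.
by apply/locally_idempotentP => -[].
Qed.

(** Sort the kernel classes A of the base point [ord0] by size m = #|A|; those of
    size m correspond to the subsets of size m - 1 of the other points. *)
Lemma e_recurrence ok n : 0 < n ->
  e (diagrams ok n) =
  \sum_(1 <= m < n.+1) 'C(n.-1, m.-1) * c (diagrams ok m) * e (diagrams ok (n - m)).
Proof.
case: n => // n _; rewrite e_diagrams (card_idempotents ok ord0).
rewrite big_add1 big_mkord /=.
have sz (A : {set 'I_n.+1}) : ord0 \in A -> #|A|.-1 < n.+1.
  by move=> A0; have := max_card (mem A); rewrite card_ord (cardD1 ord0) A0.
(* The sum is indexed by m - 1, which lies in 'I_n.+1 as #|A| > 0. *)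
rewrite (partition_big (fun A : {set 'I_n.+1} => inord #|A|.-1 : 'I_n.+1) predT) //=.
apply: eq_bigr => m _.
transitivity (\sum_(A : {set 'I_n.+1} | (ord0 \in A) && (#|A| == m.+1))
     c (diagrams ok m.+1) * e (diagrams ok (n.+1 - m.+1))).
  apply: eq_big => [A | A /andP[A0 /eqP mE]].
    have [A0 /=|//] := boolP (ord0 \in A).
    by rewrite -val_eqE /= inordK ?sz // (cardD1 ord0) A0.
  have Am : #|A| = m.+1.
    by rewrite -mE inordK ?sz // prednK // (cardD1 ord0) A0.
  rewrite card_irreducible_idempotents_ord card_idempotents_ord c_diagrams e_diagrams.
  by have -> : #|~: A| = n.+1 - m.+1; rewrite ?Am // cardsCs setCK card_ord Am.
rewrite sum_nat_const -mulnA; congr (_ * _).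
have -> : 'C(n, m) = 'C(#|[set~ (ord0 : 'I_n.+1)]|, m) by rewrite cardsC1 card_ord.
rewrite -cards_draws.
have subsetC1 (B : {set 'I_n.+1}) : (B \subset [set~ ord0]) = (ord0 \notin B).
  by rewrite -setCS setCK sub1set inE.
rewrite -(card_in_imset (f := fun B => ord0 |: B)) => [|B C]; last first.
  rewrite !inE !subsetC1 => /andP[nB _] /andP[nC _] eqBC.
  by rewrite -(setU1K nB) -(setU1K nC) eqBC.
apply: eq_card => A; rewrite [LHS]unfold_in.
apply/andP/imsetP => [[A0 /eqP Am] | [B]].
  exists (A :\ ord0); last by rewrite setD1K.
  by move: Am; rewrite inE subsetC1 setD11 (cardsD1 ord0 A) A0 add1n => -[->] /=.
by rewrite inE subsetC1 => /andP[nB /eqP Bm] ->; rewrite setU11 cardsU1 nB Bm.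
Qed.

(** * The exponential formula *)

Section ExponentialFormula.

Implicit Types (n m i : nat) (s : seq nat).

Lemma intpart_of_seq n s : 0 \notin s -> sumn s = n ->
  {mu : intpart n | perm_eq (parts mu) s}.
Proof.
move=> s0 sn; apply: sigW; have ps : perm_eq (sort geq s) s by rewrite perm_sort.
have [|mu muE] := @intpart_complete n (sort geq s); last by exists mu; rewrite muE.
apply/and3P; split; last by rewrite (perm_sumn ps) sn.
  by apply: sort_sorted => x y; apply: leq_total.
by rewrite (perm_mem ps).
Qed.

(** An integer partition is determined by the multiset of its parts, so that
    multisets may be used instead of sorted sequences. *)
Lemma parts_inj n (mu nu : intpart n) : perm_eq (parts mu) (parts nu) -> mu = nu.
Proof.
have srt (la : intpart n) : sorted geq (parts la) by case/and3P: (parts_bseqP la).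
move=> /(sorted_eq _ _ (srt mu) (srt nu)) eqp.
apply/val_inj/val_inj/(inj_map val_inj)/eqp.
- by move=> y x z xy yz; apply: leq_trans yz xy.
- by move=> x y; rewrite andbC; apply: anti_leq.
Qed.

Lemma parts_gt0 n (mu : intpart n) : 0 \notin parts mu.
Proof. by case/and3P: (parts_bseqP mu). Qed.

Lemma sumn_parts n (mu : intpart n) : sumn (parts mu) = n.
Proof. by case/and3P: (parts_bseqP mu) => _ _ /eqP. Qed.

Lemma parts_le n (mu : intpart n) i : i \in parts mu -> i <= n.
Proof. by case/mapP=> p _ ->; rewrite -ltnS ltn_ord. Qed.

Lemma mult_gt n (mu : intpart n) i : n < i -> mult mu i = 0.
Proof. by move=> ni; apply/count_memPn; apply: contraL ni => /parts_le; rewrite -leqNgt. Qed.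

Lemma sum_mult n (mu : intpart n) : \sum_(1 <= i < n.+1) i * mult mu i = n.
Proof.
rewrite -[RHS](sumn_parts mu) /mult; have: {in parts mu, forall i, i <= n}.
  by move=> i /parts_le.
elim: (parts mu) => [|p s IHs] ple; first by rewrite big1 // => i _; rewrite muln0.
rewrite /= -IHs => [|i si]; last by apply: ple; rewrite inE si orbT.
under eq_bigr do rewrite mulnDr; rewrite big_split /=; congr (_ + _).
have lt_pn : p < n.+1 by rewrite ltnS ple ?mem_head.
transitivity (\sum_(0 <= i < n.+1) i * (p == i)); first by rewrite [RHS]big_ltn.
rewrite big_mkord (bigD1 (Ordinal lt_pn)) //= eqxx muln1 big1 ?addn0 // => i.
by rewrite -val_eqE eq_sym /= => /negPf->; rewrite muln0.
Qed.

Lemma intpart_extend n m (mu : intpart (n - m)) : 0 < m <= n ->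
  {nu : intpart n | perm_eq (parts nu) (m :: parts mu)}.
Proof.
case/andP=> m_gt0 le_mn; apply: intpart_of_seq; last by rewrite /= sumn_parts subnKC.
by rewrite inE negb_or parts_gt0 andbT neq_ltn m_gt0.
Qed.

Local Open Scope ring_scope.

Variable R : numFieldType.
Implicit Type x : nat -> R.

(** The term of exp (sum_i x_i t ^ i) indexed by mu. *)
Definition weight x n (mu : intpart n) : R :=
  \prod_(1 <= i < n.+1) (x i ^+ mult mu i / (mult mu i)`!%:R).

Lemma weight_widen x n N (mu : intpart n) : (n <= N)%N ->
  \prod_(1 <= i < N.+1) (x i ^+ mult mu i / (mult mu i)`!%:R) = weight x mu.
Proof.
move=> le_nN; rewrite (big_cat_nat (n := n.+1)) //= [X in _ * X]big_nat [X in _ * X]big1 ?mulr1 //.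
by move=> i /andP[ni _]; rewrite (mult_gt mu ni) expr0 fact0 divr1.
Qed.

(** Adding a part m raises its multiplicity k to k + 1, and
    (k + 1) x^(k + 1) / (k + 1)! = x (x^k / k!). *)
Lemma weight_extend x n m (mu : intpart (n - m)) (nu : intpart n) :
    (0 < m <= n)%N -> perm_eq (parts nu) (m :: parts mu) ->
  (mult nu m)%:R * weight x nu = x m * weight x mu.
Proof.
move=> /andP[m_gt0 le_mn] nuE.
have multE i : mult nu i = ((m == i) + mult mu i)%N.
  by rewrite /mult (permP nuE).
have m_in : m \in index_iota 1 n.+1 by rewrite mem_index_iota m_gt0 ltnS.
rewrite -(weight_widen x mu (leq_subr m n)) /weight.
rewrite !(bigD1_seq m m_in (iota_uniq _ _)) /= !mulrA; congr (_ * _); last first.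
  by apply: eq_bigr => i /negPf im; rewrite multE eq_sym im.
rewrite multE eqxx add1n factS natrM exprS invfM !mulrA.
have S_neq0 : (mult mu m).+1%:R != 0 :> R by rewrite pnatr_eq0.
by rewrite [_ * x m]mulrC -!mulrA; congr (_ * _); rewrite mulrCA mulVKf.
Qed.

(** The partitions of n with a part m correspond to the partitions of n - m, and
    the others contribute nothing. *)
Lemma sum_weight_part x n m : (0 < m <= n)%N ->
  \sum_(mu : intpart n) (mult mu m)%:R * weight x mu =
  x m * \sum_(mu : intpart (n - m)) weight x mu.
Proof.
move=> mP; pose ext mu := sval (intpart_extend mu mP).
have extP mu : perm_eq (parts (ext mu)) (m :: parts mu).
  by rewrite /ext; case: intpart_extend.
have ext_inj : injective ext.
  move=> mu nu eq_mn; apply: parts_inj; rewrite -(perm_cons m).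
  by rewrite -(permPl (extP mu)) eq_mn extP.
rewrite mulr_sumr (bigID (mem (ext @: [set: intpart (n - m)]))) /= addrC big1 => [|mu].
  rewrite add0r big_imset /=; last by move=> mu nu _ _ /ext_inj.
  by apply: eq_big => [mu|mu _]; rewrite ?inE // (weight_extend _ mP (extP mu)).
have [m_mu|/count_memPn m_mu] := boolP (m \in parts mu); last first.
  by rewrite /mult m_mu mul0r.
case/imsetP; have [||nu nuE] := @intpart_of_seq (n - m) (rem m (parts mu)).
- by apply: contra (parts_gt0 mu); apply: mem_rem.
- by rewrite -[n in RHS](sumn_parts mu) (perm_sumn (perm_to_rem m_mu)) /= addKn.
exists nu; rewrite ?inE //; apply: parts_inj.
rewrite (permPr (extP nu)) (permPl (perm_to_rem m_mu)) perm_cons perm_sym.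
exact: nuE.
Qed.

Lemma sum_weight0 x : \sum_(mu : intpart 0) weight x mu = 1.
Proof.
have [mu _] := @intpart_of_seq 0 [::] isT erefl.
rewrite (bigD1 mu) //= big1 ?addr0 /weight ?big_nil ?big_geq // => nu /negP[].
apply/eqP/parts_inj; have nil0 (la : intpart 0) : parts la = [::].
  by apply/size0nil/eqP; rewrite size_map -leqn0 size_bseq.
by rewrite !nil0.
Qed.

(** In generating series, t F' = (t X') F for F = exp X. *)
Lemma sum_weight_recurrence x n :
  n%:R * \sum_(mu : intpart n) weight x mu =
  \sum_(1 <= m < n.+1) m%:R * x m * \sum_(mu : intpart (n - m)) weight x mu.
Proof.
transitivity (\sum_(mu : intpart n) \sum_(1 <= m < n.+1)
                m%:R * ((mult mu m)%:R * weight x mu)).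
  rewrite mulr_sumr; apply: eq_bigr => mu _; rewrite -{1}(sum_mult mu).
  by rewrite natr_sum mulr_suml; apply: eq_bigr => m _; rewrite natrM mulrA.
rewrite exchange_big /=; apply: eq_big_nat => m mP.
by rewrite -mulr_sumr sum_weight_part ?mulrA.
Qed.

(** Multiplying the recurrence by n turns n binomial (n - 1, m - 1) into
    m binomial (n, m); after division by n! it is the recurrence of
    [sum_weight_recurrence] for x_i = b_i / i!, and both have the same start. *)
Lemma exponential_formula (a b : nat -> nat) : a 0%N = 1%N ->
    (forall n, (0 < n)%N ->
       a n = (\sum_(1 <= m < n.+1) 'C(n.-1, m.-1) * b m * a (n - m))%N) ->
  forall n, (a n)%:R = n`!%:R * \sum_(mu : intpart n)
    \prod_(1 <= i < n.+1)
      ((b i)%:R ^+ mult mu i / ((mult mu i)`!%:R * i`!%:R ^+ mult mu i)) :> R.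
Proof.
move=> a0 aS n; pose x i : R := (b i)%:R / i`!%:R.
have fact_neq0 k : k`!%:R != 0 :> R by rewrite pnatr_eq0 -lt0n fact_gt0.
transitivity (n`!%:R * \sum_(mu : intpart n) weight x mu); last first.
  congr (_ * _); apply: eq_bigr => mu _; apply: eq_bigr => i _.
  by rewrite expr_div_n invfM mulrA mulrAC.
elim/ltn_ind: n => -[_|n IHn]; first by rewrite a0 sum_weight0 mulr1.
have n_neq0 : n.+1%:R != 0 :> R by rewrite pnatr_eq0.
apply: (mulfI n_neq0); rewrite mulrCA sum_weight_recurrence aS // natr_sum.
rewrite !mulr_sumr; apply: eq_big_nat => m /andP[m_gt0 le_mn].
rewrite (natrM _ _ (a _)) (natrM _ _ (b m)) (IHn (n.+1 - m)%N) ?ltn_subrL ?m_gt0 //.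
have binE : n.+1%:R * 'C(n, m.-1)%:R * (m`!%:R * (n.+1 - m)`!%:R) =
            m%:R * n.+1`!%:R :> R.
  rewrite -(bin_fact (le_mn : (m <= n.+1)%N)) -!natrM (mul_bin_diag n.+1 m.-1).
  by rewrite prednK // !mulnA.
rewrite /x !mulrA; congr (_ * _).
apply: (mulIf (fact_neq0 m)); transitivity (m%:R * n.+1`!%:R * (b m)%:R : R).
  by rewrite -binE; ring.
by rewrite mulfVK // [m%:R * _]mulrC.
Qed.

End ExponentialFormula.

Theorem theorem7 (K : forall n : nat, {set diagram n})
    (hK : K = all_partitions \/ K = brauer \/ K = partial_brauer) :
  (forall n : nat,
     ((e (K n))%:R =
        (n`!)%:R *
        \sum_(mu : intpart n) \prod_(1 <= i < n.+1)
          ((c (K i))%:R ^+ mult mu i /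
             ((mult mu i)`!%:R * (i`!)%:R ^+ mult mu i)) :> rat)%R) /\
  e (K 0) = 1 /\
  (forall n : nat, 1 <= n ->
     e (K n) =
       \sum_(1 <= m < n.+1) 'C(n.-1, m.-1) * c (K m) * e (K (n - m))).
Proof.
have [ok KE] : exists ok : pred nat, forall n, K n = diagrams ok n.
  (* The sizes of blocks that are allowed: any, exactly 2, at most 2. *)
  case: hK => [->|[->|->]]; [exists predT | exists (pred1 2) | exists (geq 2)] => n //.
  by apply/setP => a; rewrite !inE; symmetry; apply/forall_inP.
have e0 : e (K 0) = 1 by rewrite KE e_diagrams0.
have eS n : 0 < n ->
    e (K n) = \sum_(1 <= m < n.+1) 'C(n.-1, m.-1) * c (K m) * e (K (n - m)).
  by move=> n_gt0; rewrite KE e_recurrence //; apply: eq_bigr => m _; rewrite !KE.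
split; last by split.
exact: (exponential_formula rat (a := fun n => e (K n)) (b := fun n => c (K n)) e0 eS).
Qed.
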